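(* Let $d$ be a bounded distance on $\mathcal{S}^{q-1}$ and let $H$ be a probability distribution on $\mathcal{S}^{q-1}$. Let $\theta_d(H)$ be a deepest point of $D_d(\theta,H)$, i.e., a maximizer of $\theta\mapsto D_d(\theta,H)$ over $\mathcal{S}^{q-1}$. Then the breakdown point of $\theta_d(H)$ is larger than or equal to $$\frac{D_d(\theta_d(H),H)-D_d(-\theta_d(H),H)}{2d^{\rm sup}}.$$
   Context: Let $q\ge 2$ and $\mathcal{S}^{q-1}=\{x\in\mathbb{R}^q: x'x=1\}$, where $'$ denotes transpose. A distance $d$ on $\mathcal{S}^{q-1}$ is a metric on this set. For a bounded distance $d$ put $d^{\rm sup}=\sup\{d(\theta,\psi):\theta,\psi\in\mathcal{S}^{q-1}\}$. For a (Borel probability) distribution $H$ on $\mathcal{S}^{q-1}$, the directional $d$-depth of $\theta\in\mathcal{S}^{q-1}$ with respect to $H$ is $D_d(\theta,H)=d^{\rm sup}-E_H[d(\theta,W)]$, where $E_H$ is expectation when $W$ has distribution $H$; it is understood that $w\mapsto d(\theta,w)$ is Borel measurable for every $\theta$, so that this expectation makes sense. The breakdown point of a deepest point $\theta_d(H)$ is the infimum of the $\varepsilon\in[0,1]$ such that, for some contaminating probability distribution $G$ on $\mathcal{S}^{q-1}$, the point $-\theta_d(H)$ is a deepest point of (i.e., maximizes over $\mathcal{S}^{q-1}$) $\theta\mapsto D_d(\theta,H_\varepsilon)$, where $H_\varepsilon=(1-\varepsilon)H+\varepsilon G$. *)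

(* Defs.v *)
From HB Require Import structures.
From mathcomp Require Import all_boot all_order all_algebra.
From mathcomp Require Import all_classical all_reals all_analysis.

Set Implicit Arguments.
Unset Strict Implicit.
Unset Printing Implicit Defensive.

Import Order.TTheory GRing.Theory Num.Theory.
Import numFieldNormedType.Exports.

Local Open Scope classical_set_scope.
Local Open Scope ring_scope.

Definition unit_sphere (R : realType) (q : nat) : set 'cV[R]_q :=
  [set x | x^T *m x = 1%:M].

(* The bound [hq] is a (phantom) parameter of the type because MathComp-Analysis
   requires measurable types to be inhabited. *)
Definition sphere (R : realType) (q : nat) (hq : (2 <= q)%N) : Type :=
  set_type (@unit_sphere R q).

Lemma unit_sphere_delta (R : realType) (q : nat) (i : 'I_q) :
  unit_sphere (delta_mx i 0 : 'cV[R]_q).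
Proof.
rewrite /unit_sphere/= trmx_delta mul_delta_mx.
by apply/matrixP => j k; rewrite !ord1 !mxE.
Qed.

Lemma unit_sphereN (R : realType) (q : nat) (x : 'cV[R]_q) :
  unit_sphere x -> unit_sphere (- x).
Proof.
rewrite /unit_sphere/=.
have -> : (- x)^T = - x^T by apply/matrixP => i j; rewrite !mxE.
by rewrite mulNmx mulmxN opprK.
Qed.

Section sphere_instances.
Variables (R : realType) (q : nat) (hq : (2 <= q)%N).

Definition sphere_base : sphere R hq :=
  SigSub (mem_set (unit_sphere_delta R (Ordinal (ltnW hq)))).

(* Subspace topology inherited from R^q. *)
HB.instance Definition _ := Topological.copy (sphere R hq)
  (set_type (@unit_sphere R q)).
HB.instance Definition _ := isPointed.Build (sphere R hq) sphere_base.

(* Borel sigma-algebra, generated by the open sets of the subspace topology. *)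
HB.instance Definition _ := Measurable.copy (sphere R hq)
  (g_sigma_algebraType (@open (sphere R hq))).

Definition antipode (x : sphere R hq) : sphere R hq :=
  SigSub (mem_set (unit_sphereN (set_mem (valP x)))).

End sphere_instances.

Record is_distance (R : realType) (T : Type) (d : T -> T -> R) : Prop := {
  distance_ge0 : forall x y, 0 <= d x y;
  distance_eq0 : forall x y, d x y = 0 <-> x = y;
  distance_sym : forall x y, d x y = d y x;
  distance_triangle : forall x y z, d x z <= d x y + d y z }.

Definition bounded_distance (R : realType) (T : Type) (d : T -> T -> R) : Prop :=
  is_distance d /\ exists M, forall x y, d x y <= M.

Definition dsup (R : realType) (T : Type) (d : T -> T -> R) : R :=
  sup [set d x y | x in [set: T] & y in [set: T]].

Section contamination.
Context (disp : measure_display) (T : measurableType disp) (R : realType).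
Variables (H G : probability T R) (e : {i01 R}).

(* (1 - e) H + e G; see contaminationE. *)
Definition contamination : set T -> \bar R :=
  measure_add (mscale (1 - e%:num)%:nng H) (mscale e%:num%:nng G).

HB.instance Definition _ := Measure.on contamination.

Lemma contaminationE (A : set T) :
  contamination A = ((1 - e%:num)%:E * H A + e%:num%:E * G A)%E.
Proof. by rewrite /contamination measure_addE. Qed.

Let contamination_setT : contamination [set: T] = 1%E.
Proof.
by rewrite contaminationE !probability_setT !mule1 -EFinD subrK.
Qed.

HB.instance Definition _ :=
  Measure_isProbability.Build _ _ _ contamination contamination_setT.

End contamination.

Section depth.
Variables (R : realType) (q : nat) (hq : (2 <= q)%N).
Local Notation S := (sphere R hq).
Implicit Types (d : S -> S -> R) (H G : probability S R) (theta : S).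

(* [fine] is harmless: the expectation of a bounded measurable function is
   finite. *)
Definition depth d theta H : R := dsup d - fine 'E_H[d theta].

Definition deepest d H theta : Prop :=
  forall psi, depth d psi H <= depth d theta H.

(* The infimum is over a nonempty set: e = 1 is attained by the point mass at
   [antipode theta]. *)
Definition breakdown_point d H theta : R :=
  inf [set e%:num | e in [set e : {i01 R} |
    exists G, deepest d (contamination H G e) (antipode theta)]].

End depth.

(* Main.v *)
Require Import Defs.
From mathcomp Require Import all_boot all_order all_algebra.
From mathcomp Require Import all_classical all_reals all_analysis.
From mathcomp Require Import measurable_realfun lra.
Import Order.TTheory GRing.Theory Num.Theory.
Local Open Scope classical_set_scope.
Local Open Scope ring_scope.

(** Mixing laws mixes depths: [D(x, (1 - e) H + e G)] is
    [(1 - e) D(x, H) + e D(x, G)], because the expectation is affine in the law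
    ([depth_contamination]).  Moreover a depth always lies between [0] and
    [dsup d], because [d] does ([depth_bounds]).  Write [gap] for
    [D(theta, H) - D(- theta, H)].  If [- theta] is deepest under the mixture,
    it is in particular at least as deep as [theta], so that
      [(1 - e) gap <= e (D(- theta, G) - D(theta, G)) <= e dsup],
    and [gap <= dsup] turns this into [gap <= 2 e dsup].  Hence every [e] that
    causes breakdown is at least [gap / (2 dsup)], and so is their infimum,
    provided that some [e] does cause breakdown: an infimum over the empty set
    would be [0].  Total contamination by the point mass at [- theta] does
    ([deepest_total_contamination]). *)

Lemma expectation_contamination disp (T : measurableType disp) (R : realType)
    (H G : probability T R) (e : {i01 R}) (f : T -> R) :
  measurable_fun [set: T] f -> (forall x, 0 <= f x) ->
  ('E_(contamination H G e)[f] =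
    (1 - e%:num)%:E * 'E_H[f] + e%:num%:E * 'E_G[f])%E.
Proof.
move=> mf f0.
have /measurable_EFinP mEf := mf.
have Ef0 x : [set: T] x -> (0 <= (EFin \o f) x)%E by rewrite lee_fin.
rewrite unlock.
rewrite (ge0_integral_measure_add (mscale _ H) (mscale _ G) measurableT Ef0 mEf).
by rewrite !(ge0_integral_mscale _ measurableT _ mEf Ef0).
Qed.

Lemma expectation_dirac disp (T : measurableType disp) (R : realType)
    (a : T) (f : T -> R) :
  measurable_fun [set: T] f -> ('E_(\d_a : probability T R)[f] = (f a)%:E)%E.
Proof.
move=> mf; rewrite unlock integral_dirac//; last exact/measurable_EFinP.
by rewrite diracT mul1e.
Qed.

Lemma expectation_bounds disp (T : measurableType disp) (R : realType)
    (P : probability T R) (f : T -> R) (M : R) :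
  measurable_fun [set: T] f -> (forall x, 0 <= f x <= M) ->
  (0 <= 'E_P[f] <= M%:E)%E.
Proof.
move=> mf fM.
have f0 x : 0 <= f x by case/andP: (fM x).
rewrite expectation_ge0//= -(expectation_cst P M) expectation_le//.
- by move=> x; case/andP: (fM x) => /le_trans; apply.
- by apply/aeW => x; case/andP: (fM x).
Qed.

Section depth_bounded_distance.
Variables (R : realType) (q : nat) (hq : (2 <= q)%N).
Local Notation S := (sphere R hq).
Variable d : S -> S -> R.
Hypothesis hd : bounded_distance d.
Hypothesis hmeas : forall x : S, measurable_fun [set: S] (d x).
Implicit Types (H G : probability S R) (x : S) (e : {i01 R}).

Lemma distance_le_dsup x y : d x y <= dsup d.
Proof.
case: hd => _ [M dM]; apply: ub_le_sup; last by exists x => //; exists y.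
by exists M => _ [u _ [v _ <-]].
Qed.

Lemma distance_bounds x y : 0 <= d x y <= dsup d.
Proof. by case: hd => -[d0 _ _ _] _; rewrite d0 distance_le_dsup. Qed.

Lemma expectation_distance_fin_num x H : ('E_H[d x] \is a fin_num)%E.
Proof.
have /andP[E0 EM] := expectation_bounds _ _ _ H _ _ (hmeas x) (distance_bounds x).
by rewrite ge0_fin_numE// (le_lt_trans EM)// ltry.
Qed.

Lemma depth_bounds x H : 0 <= depth d x H <= dsup d.
Proof.
have := expectation_bounds _ _ _ H _ _ (hmeas x) (distance_bounds x).
rewrite -(fineK (expectation_distance_fin_num x H)) !lee_fin /depth.
by move=> /andP[E0 EM]; rewrite subr_ge0 EM gerBl.
Qed.

Lemma depth_contamination x H G e :
  depth d x (contamination H G e) =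
    (1 - e%:num) * depth d x H + e%:num * depth d x G.
Proof.
have d0 y : 0 <= d x y by case/andP: (distance_bounds x y).
rewrite /depth expectation_contamination//.
rewrite -(fineK (expectation_distance_fin_num x H)).
rewrite -(fineK (expectation_distance_fin_num x G)) /=.
lra.
Qed.

Lemma depth_dirac x a : depth d x (\d_a : probability S R) = dsup d - d x a.
Proof. by rewrite /depth expectation_dirac. Qed.

(** The whole mass sits at [a], which is at distance [0] from itself and hence
    has the largest depth possible, [dsup d]. *)
Lemma deepest_total_contamination H a e :
  e%:num = 1 -> deepest d (contamination H (\d_a : probability S R) e) a.
Proof.
move=> e1 x; rewrite !depth_contamination e1 subrr !mul0r !add0r !mul1r.
rewrite !depth_dirac.
have -> : d a a = 0 by case: hd => -[_ /(_ a a)[_ ->]].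
by rewrite lerD2l lerN2; case/andP: (distance_bounds x a).
Qed.

Lemma depth_gap_le_contamination x y H G e :
  deepest d (contamination H G e) y ->
  depth d x H - depth d y H <= e%:num * (2 * dsup d).
Proof.
move=> /(_ x); rewrite !depth_contamination.
have /andP[_ xH] := depth_bounds x H.
have /andP[yH _] := depth_bounds y H.
have /andP[xG _] := depth_bounds x G.
have /andP[_ yG] := depth_bounds y G.
have e0 : 0 <= e%:num by [].
set D := dsup d in xH yG *.
(* Deepness of y bounds only the share 1 - e of the gap; [gapH] bounds the
   share e, which is where the factor 2 in the statement comes from. *)
have gapH : e%:num * (depth d x H - depth d y H) <= e%:num * D.
  by apply: ler_wpM2l => //; lra.
have gapG : e%:num * (depth d y G - depth d x G) <= e%:num * D.
  by apply: ler_wpM2l => //; lra.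
lra.
Qed.

End depth_bounded_distance.

Theorem theorem9 (R : realType) (q : nat) (hq : (2 <= q)%N)
    (d : sphere R hq -> sphere R hq -> R) (hd : bounded_distance d)
    (hmeas : forall theta : sphere R hq, measurable_fun [set: sphere R hq] (d theta))
    (H : probability (sphere R hq) R)
    (theta : sphere R hq) (htheta : deepest d H theta) :
  (depth d theta H - depth d (antipode theta) H) / (2 * dsup d)
    <= breakdown_point d H theta.
Proof.
apply: lb_le_inf.
  exists (1%:i01 : {i01 R})%:num, 1%:i01 => //=.
  by exists (\d_(antipode theta)); apply: deepest_total_contamination.
move=> _ [e [G eG] <-].
have /andP[d0 dD] := distance_bounds _ _ _ _ hd theta theta.
have := le_trans d0 dD; rewrite le0r => /orP[/eqP ->|dsup_gt0].
  by rewrite mulr0 invr0 mulr0.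
by rewrite ler_pdivrMr ?mulr_gt0//; apply: depth_gap_le_contamination eG.
Qed.
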